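(* Let $p>q$ be positive integers and let $\beta>0$. Consider index difference $\triangle n=1$ and set $$R(\gamma)=\beta\left[s_{2p+1}(\gamma)-1\right]-\left[s_{2q+1}(\gamma)-1\right],\qquad \beta_0^{(\triangle n=1)}=\frac{2q+1}{2p+1},\qquad \beta_{-1/4}^{(\triangle n=1)}=\frac{1-2^{-2q}}{1-2^{-2p}},$$ where $s_0=2$, $s_1=1$, $s_{m+1}(\gamma)=s_m(\gamma)+\gamma s_{m-1}(\gamma)$ for $m\ge1$. For the linearized problem $v_t=cv_x+Av_{(2q+1)x}+Bv_{(2p+1)x}$ at zero amplitude with $c=c_1=\beta-1$, where $A(-1)^q=1$ and $-B(-1)^p=\beta$, the presence and character of collisions of eigenvalues whose Fourier indices differ by $\triangle n=1$ are as follows. (i) For $\beta<\beta_0^{(\triangle n=1)}$, eigenvalues of the same signature collide, i.e., there is a root $\gamma>0$ of $R(\gamma)=0$, and there is no root $\gamma\in[-1/4,0)$. (ii) For $\beta_0^{(\triangle n=1)}<\beta<\beta_{-1/4}^{(\triangle n=1)}$, eigenvalues of opposite signature collide, i.e., there is a root $\gamma\in[-1/4,0)$ of $R(\gamma)=0$. (iii) For $\beta_{-1/4}^{(\triangle n=1)}<\beta$, eigenvalues do not collide, i.e., $\gamma<-1/4$ for all nonzero real roots $\gamma$ of $R(\gamma)=0$.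
   Context: The linearized problem arises from $u_t=\partial_xf(u)+A\,\partial_x^{2q+1}u+B\,\partial_x^{2p+1}u$ with $2\pi$-periodic boundary conditions, in a frame moving with velocity $c$; $v_{(m)x}$ denotes $\partial_x^mv$. Its dispersion relation, with $\alpha=A(-1)^q$ normalized to $1$ and $\beta=-B(-1)^p$, is $\Omega(k)=-ck-k^{2q+1}+\beta k^{2p+1}$. The value $c=c_1=\beta-1$ is chosen so that $\Omega(1)=0$. The eigenvalues are $\lambda_n^{(\tilde\mu)}=-i\Omega(n+\tilde\mu)$, $n\in\mathbb{Z}$, $\tilde\mu\in(-1/2,1/2]$. With $\mu=n_2+\tilde\mu$ and $n_1-n_2=1$, the collision condition $\lambda_{n_1}^{(\tilde\mu)}=\lambda_{n_2}^{(\tilde\mu)}$ is $\Omega(\mu+1)=\Omega(\mu)$, and $\Omega(\mu+1)-\Omega(\mu)=R(\gamma)$ with $\gamma=\mu(\mu+1)$. The Krein signature of a nonzero $\lambda_n^{(\tilde\mu)}$ is $-\operatorname{sign}\left(\Omega(n+\tilde\mu)/(n+\tilde\mu)\right)$. Convention: ''collision of eigenvalues of opposite (same) signature'' means that $R$ has a real root $\gamma\in[-1/4,0)$ (respectively $\gamma>0$); real $\mu$ corresponds to real $\gamma\ge-1/4$. For $\triangle n=1$, $\gamma=0$ is always a root of $R$, corresponding to $\Omega(1)=0=\Omega(0)$; this collision at the origin, due to symmetries, is disregarded. The precise content of each item is the statement after ''i.e.''. *)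

(* Defs.v *)
From mathcomp Require Import all_boot all_order all_algebra.
From mathcomp Require Import reals complex.
From mathcomp Require Import ring lra.

Set Implicit Arguments.
Unset Strict Implicit.
Unset Printing Implicit Defensive.

Import Order.TTheory GRing.Theory Num.Theory.
Local Open Scope ring_scope.

Fixpoint s (R : realType) (m : nat) (gamma : R) : R :=
  match m with
  | 0 => 2
  | 1 => 1
  | (m'.+1 as n).+1 => s n gamma + gamma * s m' gamma
  end.

(* The function R(gamma) of the problem; the name R is kept for the reals. *)
Definition Rgamma (R : realType) (p q : nat) (beta gamma : R) : R :=
  beta * (s (2 * p + 1) gamma - 1) - (s (2 * q + 1) gamma - 1).

Definition beta_0 (R : realType) (p q : nat) : R :=
  (2 * q + 1)%:R / (2 * p + 1)%:R.

(* The threshold beta_{-1/4}, at which gamma = -1/4 is a root of Rgamma. *)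
Definition beta_m14 (R : realType) (p q : nat) : R :=
  (1 - 2 ^- (2 * q)) / (1 - 2 ^- (2 * p)).

(* The eigenvalue of v |-> c v_x + A v_{(2q+1)x} + B v_{(2p+1)x} on
   x |-> exp (i k x), where k = n + mu~ is the shifted Fourier index. *)
Definition eigenvalue (R : realType) (p q : nat) (A B c k : R) : R[i] :=
  let ik := 'i%C * k%:C%C in
  c%:C%C * ik + A%:C%C * ik ^+ (2 * q + 1) + B%:C%C * ik ^+ (2 * p + 1).

Definition Omega (R : realType) (p q : nat) (beta c k : R) : R :=
  - (c * k) - k ^+ (2 * q + 1) + beta * k ^+ (2 * p + 1).

Definition krein (R : realType) (p q : nat) (beta c k : R) : R :=
  - Num.sg (Omega p q beta c k / k).

(* The remaining facts justify reading collisions of eigenvalues off the real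
   roots of Rgamma: with gamma = mu (mu + 1), the eigenvalues of indices mu and
   mu + 1 coincide iff Rgamma vanishes at gamma, and a nonzero colliding pair
   has opposite signatures iff gamma < 0. *)

Lemma eigenvalueE (R : realType) (p q : nat) (A B beta c k : R) :
  A * (-1) ^+ q = 1 -> - B * (-1) ^+ p = beta ->
  eigenvalue p q A B c k = - 'i%C * (Omega p q beta c k)%:C%C.
Proof.
move=> hA hB; rewrite /eigenvalue /Omega /=.
have pw m : ('i%C * k%:C%C : R[i]) ^+ (2 * m + 1)
    = 'i%C * ((-1) ^+ m * k ^+ (2 * m + 1))%:C%C.
  by rewrite exprMn exprD exprM sqr_i expr1 rmorphM !rmorphXn /= rmorphN1; ring.
rewrite !pw -hB.
have -> : A%:C%C * ('i%C * ((-1) ^+ q * k ^+ (2 * q + 1))%:C%C)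
    = 'i%C * (A * (-1) ^+ q * k ^+ (2 * q + 1))%:C%C :> R[i].
  by rewrite !rmorphM; ring.
rewrite hA !(rmorphD, rmorphB, rmorphN, rmorphM) /= rmorph1; ring.
Qed.

Lemma sE (R : realType) (m : nat) (mu : R) :
  s m (mu * (mu + 1)) = (mu + 1) ^+ m + (- mu) ^+ m.
Proof.
have [] : s m (mu * (mu + 1)) = (mu + 1) ^+ m + (- mu) ^+ m /\
  s m.+1 (mu * (mu + 1)) = (mu + 1) ^+ m.+1 + (- mu) ^+ m.+1; last by [].
elim: m => [|m [IH0 IH1]]; first by split=> /=; rewrite ?expr0 ?expr1; ring.
split=> //; rewrite -[LHS]/(s m.+1 _ + _ * s m _) IH0 IH1 !exprS; ring.
Qed.

Lemma Omega_diff (R : realType) (p q : nat) (beta mu : R) :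
  Omega p q beta (beta - 1) (mu + 1) - Omega p q beta (beta - 1) mu
  = Rgamma p q beta (mu * (mu + 1)).
Proof.
have od m : (- mu) ^+ (2 * m + 1) = - mu ^+ (2 * m + 1).
  by rewrite exprNn -signr_odd oddD oddM /= expr1 mulN1r.
rewrite /Rgamma /Omega !sE !od; ring.
Qed.

Lemma eigenvalue_collision (R : realType) (p q : nat) (A B beta mu : R) :
  A * (-1) ^+ q = 1 -> - B * (-1) ^+ p = beta ->
  eigenvalue p q A B (beta - 1) (mu + 1) = eigenvalue p q A B (beta - 1) mu
  <-> Rgamma p q beta (mu * (mu + 1)) = 0.
Proof.
move=> hA hB; rewrite !(eigenvalueE _ _ hA hB) -Omega_diff.
split=> [|/subr0_eq -> //].
have iN0 : - 'i%C != 0 :> R[i] by rewrite oppr_eq0 eq_complex /= oner_eq0 andbF.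
by move/(mulfI iN0)=> [->]; rewrite subrr.
Qed.

Lemma krein_collision (R : realType) (p q : nat) (beta c mu : R) :
  Omega p q beta c (mu + 1) = Omega p q beta c mu ->
  Omega p q beta c mu != 0 ->
  krein p q beta c (mu + 1) = - krein p q beta c mu <-> mu * (mu + 1) < 0.
Proof.
move=> eqO O0.
have z0 : Omega p q beta c 0 = 0 by rewrite /Omega !addn1 !exprS; ring.
have mu0 : mu != 0 by apply: contraNneq O0 => ->; rewrite z0.
have mu1 : mu + 1 != 0 by apply: contraNneq O0 => h; rewrite -eqO h z0.
rewrite /krein eqO !sgrM !sgrV -[mu * _ < 0]sgr_lt0 sgrM.
move: O0; rewrite -sgr_eq0.
case: (sgrP mu) mu0 => // _ _; case: (sgrP (mu + 1)) mu1 => // _ _;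
  case: sgrP => [|_|_] /=; rewrite ?eqxx // => _; split=> ?; lra.
Qed.

(* Main.v *)
(* Since s_(n+2) - s_n = gamma (s_n + s_(n-1)), we have
   s_(2m+1) - 1 = gamma Q_m with Q_m the sum over j < m of
   d_j = s_(2j+1) + s_(2j), so the nonzero roots of R are the roots of
   V = beta Q_p - Q_q.  For gamma >= -1/4 the ratio d_j(gamma) / d_j(-1/4) is
   nondecreasing in j, and for -1/4 <= gamma < 0 the ratio d_j(gamma) / d_j(0)
   is nonincreasing in j; both properties pass to the partial sums Q_m.  They
   give V > 0 on [-1/4, +oo[ in case (iii) and V < 0 on [-1/4, 0[ in case (i).
   The roots in (i) and (ii) come from the intermediate value theorem, on
   [0, 1/beta] and [-1/4, 0] respectively. *)
Require Import Defs.
From mathcomp Require Import all_boot all_order all_algebra.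
From mathcomp Require Import reals.
From mathcomp Require Import ring lra.

Import Order.TTheory GRing.Theory Num.Theory.
Local Open Scope ring_scope.

(** The pairs of indices both below [q] occur on each side and cancel; the remaining pairs have
    [i < q <= j], and the hypothesis compares them term by term. *)
Lemma ler_mul_psums (R : realType) (u v : nat -> R) (q p : nat) :
  (q <= p)%N -> (forall i j, (i <= j)%N -> u i * v j <= u j * v i) ->
  (\sum_(i < q) u i) * (\sum_(i < p) v i)
  <= (\sum_(i < p) u i) * (\sum_(i < q) v i).
Proof.
move=> qp uv; rewrite -(subnKC qp) !big_split_ord /= mulrDr mulrDl lerD2l.
rewrite !big_distrlr /= [leRHS]exchange_big /=.
by apply: ler_sum => i _; apply: ler_sum => j _; apply/uv/ltnW/ltn_addr.
Qed.

(** The [d_j] of the outline: [gamma * sgap R j gamma] is the increment from [s (2 * j + 1)] to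
    [s (2 * j + 3)]. The sums [squot] are the [Q_m]. *)
Definition sgap (R : realType) (j : nat) (gamma : R) : R :=
  s (2 * j + 1) gamma + s (2 * j) gamma.

Definition squot (R : realType) (m : nat) (gamma : R) : R :=
  \sum_(j < m) sgap R j gamma.

Lemma sSS (R : realType) (m : nat) (gamma : R) :
  s m.+2 gamma = s m.+1 gamma + gamma * s m gamma.
Proof. by []. Qed.

Lemma s_squot (R : realType) (m : nat) (gamma : R) :
  s (2 * m + 1) gamma - 1 = gamma * squot R m gamma.
Proof.
elim: m => [|m IH]; first by rewrite /squot big_ord0 /=; ring.
rewrite /squot big_ord_recr -/(squot R m gamma) mulrDr -IH /sgap.
by rewrite mulnS !addn1 add2n !sSS; ring.
Qed.

Lemma Rgamma_squot (R : realType) (p q : nat) (beta gamma : R) :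
  Rgamma p q beta gamma = gamma * (beta * squot R p gamma - squot R q gamma).
Proof. by rewrite /Rgamma !s_squot; ring. Qed.

Lemma Rgamma_eq0 (R : realType) (p q : nat) (beta gamma : R) : gamma != 0 ->
  Rgamma p q beta gamma = 0 <-> beta * squot R p gamma = squot R q gamma.
Proof.
move=> g0; rewrite Rgamma_squot; split=> [/eqP|->]; last by rewrite subrr mulr0.
by rewrite mulf_eq0 (negPf g0) subr_eq0 => /eqP.
Qed.

Lemma s_at0 (R : realType) (m : nat) : s m.+1 (0 : R) = 1.
Proof. by elim: m => // m IH; rewrite sSS IH mul0r addr0. Qed.

(** Index 0 is exceptional because [s 0] is 2, while all later [s m] equal 1 at 0. *)
Lemma sgap_at0 (R : realType) (j : nat) :
  sgap R j 0 = if j is 0 then 3 else 2.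
Proof.
case: j => [|j]; rewrite /sgap; first by rewrite /=; ring.
by rewrite mulnS addn1 !s_at0.
Qed.

Lemma squot_at0 (R : realType) (m : nat) :
  squot R m.+1 0 = (2 * m.+1 + 1)%:R.
Proof.
rewrite /squot big_ord_recl sgap_at0 (eq_bigr (fun=> 2)) => [|i _]; last first.
  by rewrite sgap_at0.
by rewrite sumr_const card_ord mulnS addnAC natrD natrM mulr_natr.
Qed.

Lemma sgapE (R : realType) (j : nat) (mu : R) :
  sgap R j (mu * (mu + 1))
  = (mu + 1) ^+ (2 * j) * (mu + 2) + mu ^+ (2 * j) * (1 - mu).
Proof. by rewrite /sgap !sE addn1 !exprS !exprM sqrrN; ring. Qed.

Lemma sgap_m14 (R : realType) (j : nat) :
  sgap R j (- (1 / 4)) = 3 * (4^-1) ^+ j.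
Proof.
(* [mu = -1/2] is the double root of [mu * (mu + 1) = -1/4], so both squares in [sgapE] become
   1/4. *)
have -> : - (1 / 4) = - (1 / 2) * (- (1 / 2) + 1) :> R by field.
rewrite sgapE !exprM.
have -> : (- (1 / 2) + 1) ^+ 2 = 4^-1 :> R by field.
have -> : (- (1 / 2)) ^+ 2 = 4^-1 :> R by field.
by field.
Qed.

Lemma squot_m14 (R : realType) (m : nat) :
  squot R m (- (1 / 4)) = 4 * (1 - 2 ^- (2 * m)).
Proof.
have := s_squot R m (- (1 / 4)).
have {1}-> : - (1 / 4) = - (1 / 2) * (- (1 / 2) + 1) :> R by field.
rewrite sE opprK.
have -> : - (1 / 2) + 1 = 2^-1 :> R by field.
rewrite mul1r addn1 exprS exprVn; lra.
Qed.

(** Choosing the larger root of the quadratic gives [|mu| <= mu + 1], so the power of [mu + 1]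
    dominates in [sgapE]. *)
Lemma m14_le_param (R : realType) (gamma : R) : - (1 / 4) <= gamma ->
  exists2 mu : R, - (1 / 2) <= mu & gamma = mu * (mu + 1).
Proof.
move=> hg; exists ((Num.sqrt (1 + 4 * gamma) - 1) / 2).
  by have := sqrtr_ge0 (1 + 4 * gamma); lra.
have h : 0 <= 1 + 4 * gamma by lra.
have := sqr_sqrtr h; set t := Num.sqrt _ => ht.
have -> : gamma = (t ^+ 2 - 1) / 4 by rewrite ht; field.
by field.
Qed.

(** By [sgap_m14], the scaled gap is three times the ratio of the gap at [gamma] to the gap at
    -1/4. *)
Lemma sgap_scaled_homo (R : realType) (gamma : R) : - (1 / 4) <= gamma ->
  {homo (fun j => 4 ^+ j * sgap R j gamma) : i j / (i <= j)%N >-> i <= j}.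
Proof.
move=> /m14_le_param [mu hmu ->].
apply: homo_leq => [//|? ? ?|j]; first exact: le_trans.
have scaledE k : 4 ^+ k * sgap R k (mu * (mu + 1))
    = (4 * (mu + 1) ^+ 2) ^+ k * (mu + 2) + (4 * mu ^+ 2) ^+ k * (1 - mu).
  by rewrite sgapE !exprM mulrDr !(mulrA (4 ^+ k)) -!exprMn.
rewrite !scaledE ![_ ^+ j.+1]exprS -subr_ge0.
have b0 : 0 <= 4 * mu ^+ 2 by rewrite mulr_ge0 ?sqr_ge0.
have z0 : 0 <= (4 * mu ^+ 2) ^+ j by rewrite exprn_ge0.
have wz : (4 * mu ^+ 2) ^+ j <= (4 * (mu + 1) ^+ 2) ^+ j.
  have le2 : 4 * mu ^+ 2 <= 4 * (mu + 1) ^+ 2 by nra.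
  by apply: lerXn2r => //; rewrite nnegrE (le_trans b0).
move: wz z0; set w := (4 * (mu + 1) ^+ 2) ^+ j.
set z := (4 * mu ^+ 2) ^+ j => wz z0.
(* The coefficient of [z] in the difference may be negative; writing [w = (w - z) + z] absorbs it
   and leaves only nonnegative terms. *)
rewrite [leRHS](_ : _ = (2 * mu + 1) *
  ((w - z) * (2 * mu + 3) * (mu + 2) + z * (5 * (2 * mu + 1)))); last by ring.
apply: mulr_ge0; first lra.
apply: addr_ge0; last by apply: mulr_ge0 => //; lra.
by apply: mulr_ge0; [apply: mulr_ge0|]; lra.
Qed.

Lemma sgap_gt0 (R : realType) (j : nat) (gamma : R) :
  - (1 / 4) <= gamma -> 0 < sgap R j gamma.
Proof.
move=> hg; have := sgap_scaled_homo R gamma hg 0 j (leq0n j).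
rewrite expr0 mul1r {1}/sgap /= => h.
rewrite -(pmulr_rgt0 _ (exprn_gt0 j (ltr0Sn R 3))).
by apply: lt_le_trans h; lra.
Qed.

Lemma squot_gt0 (R : realType) (m : nat) (gamma : R) :
  - (1 / 4) <= gamma -> 0 < squot R m.+1 gamma.
Proof.
move=> hg; rewrite /squot big_ord_recl ltr_wpDr ?sgap_gt0 //.
by apply: sumr_ge0 => i _; apply/ltW/sgap_gt0.
Qed.

Lemma squot_ratio_m14 (R : realType) (p q : nat) (gamma : R) :
  (q <= p)%N -> - (1 / 4) <= gamma ->
  squot R q gamma * squot R p (- (1 / 4))
  <= squot R p gamma * squot R q (- (1 / 4)).
Proof.
move=> qp hg; apply: (ler_mul_psums R (sgap R ^~ gamma)
  (sgap R ^~ (- (1 / 4))) q p qp) => i j ij.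
rewrite !sgap_m14.
have := sgap_scaled_homo R gamma hg i j ij.
have pi : 0 < 4 ^+ i :> R by rewrite exprn_gt0.
have pj : 0 < 4 ^+ j :> R by rewrite exprn_gt0.
rewrite !exprVn !mulrA ler_pdivlMr // mulrAC ler_pdivrMr //; lra.
Qed.

(** Here [mu] lies in [-1/2, 0[, so both squares in [sgapE] are at most 1 and their coefficients are
    positive. *)
Lemma sgapS_le (R : realType) (j : nat) (gamma : R) :
  - (1 / 4) <= gamma < 0 -> sgap R j.+2 gamma <= sgap R j.+1 gamma.
Proof.
move=> /andP[/m14_le_param [mu hmu ->]] mu0.
have {mu0} mu0 : mu < 0 by nra.
rewrite !sgapE !exprM ![_ ^+ j.+2]exprS.
have : 0 <= ((mu + 1) ^+ 2) ^+ j.+1 by rewrite exprn_ge0 ?sqr_ge0.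
have : 0 <= (mu ^+ 2) ^+ j.+1 by rewrite exprn_ge0 ?sqr_ge0.
set y := _ ^+ j.+1; set x := _ ^+ j.+1 => y0 x0.
apply: lerD; apply: ler_wpM2r; try lra; rewrite ler_piMl //; nra.
Qed.

Lemma squot_ratio_0 (R : realType) (p q : nat) (gamma : R) :
  (q <= p)%N -> - (1 / 4) <= gamma < 0 ->
  squot R q 0 * squot R p gamma <= squot R p 0 * squot R q gamma.
Proof.
move=> qp hg; apply: (ler_mul_psums R (sgap R ^~ 0) (sgap R ^~ gamma) q p qp) => i j ij.
have anti : {homo (fun j => sgap R j.+1 gamma) : i j / (i <= j)%N >-> j <= i}.
  by apply: homo_leq => [//|? ? ? /[swap]|k]; [exact: le_trans|exact: sgapS_le].
have gap1 : sgap R 1 gamma = 2 + 5 * gamma by rewrite /sgap /=; ring.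
rewrite !sgap_at0; case: i j ij => [|i] [|j] //= ij.
  (* For [i = 0 < j] the claim reduces to a gap of at most 2, and the gap is bounded by
     [2 + 5 * gamma]. *)
  have := anti 0 j (leq0n j); rewrite gap1 [sgap R 0 _]/sgap /=.
  by move: hg => /andP[]; lra.
by rewrite ler_pM2l // anti.
Qed.

Lemma s_ge0 (R : realType) (m : nat) (gamma : R) : 0 <= gamma -> 0 <= s m gamma.
Proof.
move=> g0; have [] // : 0 <= s m gamma /\ 0 <= s m.+1 gamma.
elim: m => [|m [IH0 IH1]]; first by split=> /=; lra.
by split=> //; rewrite sSS addr_ge0 ?mulr_ge0.
Qed.

(** The recurrence bounds [gamma * d_i] by [d_(i+1)]; the unmatched term [d_0] is positive and makes
    the inequality strict. *)
Lemma squotS_gt (R : realType) (m : nat) (gamma : R) :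
  0 <= gamma -> gamma * squot R m gamma < squot R m.+1 gamma.
Proof.
move=> g0; rewrite /squot big_ord_recl mulr_sumr ltr_pwDl //.
  by rewrite sgap_gt0 //; lra.
apply: ler_sum => i _; rewrite /sgap lift0 mulnS mulrDr.
have h0 := s_ge0 _ (2 * i) _ g0; have h1 := s_ge0 _ (2 * i).+1 _ g0.
by rewrite add2n !addn1 !sSS; have := mulr_ge0 g0 h0; lra.
Qed.

Lemma squot_homo (R : realType) (p q : nat) (gamma : R) :
  (q <= p)%N -> - (1 / 4) <= gamma -> squot R q gamma <= squot R p gamma.
Proof.
move=> qp hg; rewrite -(subnKC qp) /squot big_split_ord /= lerDl.
by apply: sumr_ge0 => i _; apply/ltW/sgap_gt0.
Qed.

(** Polynomial representations make [poly_ivt] applicable in [squot_ivt]. *)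
Lemma s_poly (R : realType) (m : nat) :
  exists P : {poly R}, forall x, P.[x] = s m x.
Proof.
have [] // : (exists P : {poly R}, forall x, P.[x] = s m x) /\
  (exists P : {poly R}, forall x, P.[x] = s m.+1 x).
elim: m => [|m [[P hP] [Q hQ]]].
  by split; [exists 2%:P|exists 1%:P] => x; rewrite hornerC.
split; first by exists Q.
by exists (Q + 'X * P) => x; rewrite sSS -hP -hQ !hornerE.
Qed.

Lemma squot_poly (R : realType) (m : nat) :
  exists P : {poly R}, forall x, P.[x] = squot R m x.
Proof.
elim: m => [|m [P hP]]; first by exists 0 => x; rewrite horner0 /squot big_ord0.
have [[Q hQ] [S hS]] := (s_poly R (2 * m + 1), s_poly R (2 * m)).
exists (P + (Q + S)) => x.
by rewrite !hornerD hP hQ hS /squot big_ord_recr.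
Qed.

Lemma squot_ivt (R : realType) (p q : nat) (beta a b : R) : a <= b ->
  (beta * squot R p a - squot R q a) <= 0
    <= (beta * squot R p b - squot R q b) ->
  exists2 gamma, a <= gamma <= b & beta * squot R p gamma = squot R q gamma.
Proof.
move=> ab; have [[P hP] [Q hQ]] := (squot_poly R p, squot_poly R q).
rewrite -!hP -!hQ -!hornerZ -!hornerN -!hornerD.
move=> /(poly_ivt ab)[gamma gab /rootP].
rewrite !hornerE hP hQ => /subr0_eq h; by exists gamma.
Qed.

Theorem theorem4 (R : realType) (p q : nat) (beta : R)
    (hq : (0 < q)%N) (hqp : (q < p)%N) (hbeta : 0 < beta) :
  [/\ (beta < beta_0 R p q ->
        (exists gamma : R, 0 < gamma /\ Rgamma p q beta gamma = 0) /\
        ~ (exists gamma : R,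
             - (1 / 4) <= gamma < 0 /\ Rgamma p q beta gamma = 0)),
      (beta_0 R p q < beta < beta_m14 R p q ->
        exists gamma : R,
          - (1 / 4) <= gamma < 0 /\ Rgamma p q beta gamma = 0)
    & (beta_m14 R p q < beta ->
        forall gamma : R,
          gamma <> 0 -> Rgamma p q beta gamma = 0 -> gamma < - (1 / 4))].
Proof.
have p0 : (0 < p)%N by apply: leq_ltn_trans hqp.
have squot_pos m gamma : (0 < m)%N -> - (1 / 4) <= gamma ->
    0 < squot R m gamma by case: m => // m _; exact: squot_gt0.
(* Both thresholds are values of [Q_q / Q_p], at 0 and at -1/4, so comparing [beta] with them gives
   the sign of [V] at these points. *)
have b0E : beta_0 R p q = squot R q 0 / squot R p 0.
  by rewrite /beta_0; case: (p) (q) p0 hq => [|?] [|?] // _ _; rewrite !squot_at0.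
have b14E : beta_m14 R p q = squot R q (- (1 / 4)) / squot R p (- (1 / 4)).
  by rewrite !squot_m14 /beta_m14 -mulf_div divff ?mul1r // pnatr_eq0.
have Qp0 : 0 < squot R p 0 by apply: squot_pos => //; lra.
have Qp14 : 0 < squot R p (- (1 / 4)) by apply: squot_pos.
rewrite b0E b14E; split.
- rewrite ltr_pdivlMr // => hb; split; last first.
    move=> [gamma [hg /Rgamma_eq0 h]]; have /andP[g14 g0] := hg.
    have {}h := h (ltr0_neq0 g0).
    have Qpg : 0 < squot R p gamma by apply: squot_pos.
    (* Substituting [Q_q = beta * Q_p] at the root and cancelling [Q_p > 0] gives
       [Q_q(0) <= beta * Q_p(0)], against [hb]. *)
    have := squot_ratio_0 R p q gamma (ltnW hqp) hg.
    by rewrite -h; nra.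
  have ib0 : 0 < beta^-1 by rewrite invr_gt0.
  (* At [gamma = 1/beta], [squotS_gt] gives [Q_q < beta * Q_(q+1)], and [q + 1 <= p]; hence [V > 0]
     there, while [V(0) < 0]. *)
  have big : squot R q beta^-1 < beta * squot R p beta^-1.
    rewrite -ltr_pdivrMl //; apply: lt_le_trans (squotS_gt _ _ _ (ltW ib0)) _.
    by apply: squot_homo => //; lra.
  have [|gamma /andP[g0 _] h] := squot_ivt R p q beta 0 beta^-1 (ltW ib0).
    by rewrite subr_le0 subr_ge0 !ltW.
  have gN0 : gamma != 0 by apply: contraTneq hb => g; rewrite g in h; rewrite h ltxx.
  by exists gamma; split; [rewrite lt_def gN0|apply/Rgamma_eq0].
- rewrite ltr_pdivrMr // ltr_pdivlMr // => /andP[hb0 hb14].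
  have le14 : - (1 / 4) <= 0 :> R by lra.
  (* The hypotheses say [V(-1/4) < 0 < V(0)]; strictness at 0 then excludes the root 0. *)
  have [|gamma /andP[g14 g0] h] := squot_ivt R p q beta _ _ le14.
    by rewrite subr_le0 subr_ge0 !ltW.
  have gN0 : gamma != 0.
    by apply: contraTneq hb0 => g; rewrite g in h; rewrite h ltxx.
  exists gamma; split; last by apply/Rgamma_eq0.
  by rewrite g14 lt_def eq_sym gN0.
- rewrite ltr_pdivrMr // => hb gamma /eqP gN0 /(Rgamma_eq0 _ _ _ _ _ gN0) h.
  rewrite ltNge; apply/negP => g14.
  (* A root at or above -1/4 would give [beta * Q_p(-1/4) <= Q_q(-1/4)] after cancelling
     [Q_p(gamma) > 0], against [hb]. *)
  have := squot_ratio_m14 R p q gamma (ltnW hqp) g14.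
  have := squot_pos p gamma p0 g14.
  by rewrite -h; nra.
Qed.
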